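(* Let $\mathbf{X}$ be a real vector space, let $T\ge 0$ be an integer and let $f:\mathbf{X}^{T+1}\to\overline{\mathbb{R}}$ be any function. Then \[ f^{\sharp(T)}(x_0)=\sup_{\mu\in\mathcal{M}^T(x_0)}\mu[f]\qquad\text{for all }x_0\in\mathbf{X}. \]
   Context: $\overline{\mathbb{R}}=[-\infty,\infty]$, with the convention $\infty-\infty=-\infty$ used throughout, in particular in the definitions of concavity and of integrals. A function $\psi:\mathbf{X}\to\overline{\mathbb{R}}$ is concave if $\psi(\lambda x+(1-\lambda)y)\ge\lambda\psi(x)+(1-\lambda)\psi(y)$ for all $x,y\in\mathbf{X}$, $\lambda\in(0,1)$ (with this convention). For $g:\mathbf{X}\to\overline{\mathbb{R}}$, the concave envelope is $g^\sharp(x)=\inf\{\psi(x)\mid \psi:\mathbf{X}\to\overline{\mathbb{R}}\text{ concave},\ \psi\ge g\}$. For an integer $t\ge0$ and $g:\mathbf{X}^{t+2}\to\overline{\mathbb{R}}$, define $g^{\sharp_t}:\mathbf{X}^{t+1}\to\overline{\mathbb{R}}$ by $g^{\sharp_t}(x_0,\dots,x_t)=\big(g(x_0,\dots,x_t,\cdot)\big)^\sharp(x_t)$ (concave envelope in the last variable, evaluated at $x_t$). The operation $\sharp(T)=\sharp_0\circ\cdots\circ\sharp_{T-1}$ (so $\sharp_{T-1}$ is applied first; for $T=0$ it is the identity) maps functions of $T+1$ variables to functions of one variable. A martingale is simple if it takes finitely many values. $\mathcal{M}^T(x_0)$ is the set of laws on $\mathbf{X}^{T+1}$ of $\mathbf{X}$-valued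 simple martingales $(M_0,\dots,M_T)$ with $M_0=x_0$; such laws have finite support. $\mu[f]=\int f\,d\mu$, a finite sum over the support of $\mu$ (no measurability is needed), and $\mu[f]=-\infty$ if $\mu[f^+]=\mu[f^-]=\infty$. *)

(* Defs.v *)
From HB Require Import structures.
From mathcomp Require Import all_boot all_order all_algebra.
From mathcomp Require Import all_classical all_reals all_analysis.

Set Implicit Arguments.
Unset Strict Implicit.
Unset Printing Implicit Defensive.
Import Order.TTheory GRing.Theory Num.Theory.
Local Open Scope classical_set_scope.
Local Open Scope ring_scope.

(* The addition of \bar R satisfies +oo + -oo = -oo + +oo = -oo, which is the
   convention "oo - oo = -oo" used in the definitions of concavity and of
   mu[f]. *)

Section ConcaveEnvelope.
Variables (R : realType) (X : lmodType R).

Definition concave (psi : X -> \bar R) : Prop :=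
  forall (x y : X) (l : R), 0 < l < 1 ->
    (l%:E * psi x + (1 - l)%:E * psi y <= psi (l *: x + (1 - l) *: y)%R)%E.

Definition concave_envelope (g : X -> \bar R) (x : X) : \bar R :=
  ereal_inf [set psi x | psi in
    [set psi : X -> \bar R | concave psi /\ forall y, (g y <= psi y)%E]].

(* g^{sharp_t}; a (t+1)-tuple lists x_0, ..., x_t. *)
Definition sharp_at (t : nat) (g : t.+2.-tuple X -> \bar R)
    (x : t.+1.-tuple X) : \bar R :=
  concave_envelope (fun y => g [tuple of rcons x y]) (tnth x ord_max).

(* sharp(T) = sharp_0 \o ... \o sharp_(T-1). *)
Fixpoint sharp (T : nat) :
    (T.+1.-tuple X -> \bar R) -> 1.-tuple X -> \bar R :=
  match T with
  | 0 => fun g => g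
  | T'.+1 => fun g => sharp (sharp_at g)
  end.

End ConcaveEnvelope.
Arguments sharp {R X} T.

Section SimpleMartingale.
Variables (R : realType) (X : lmodType R).

(* The integral over A of an X-valued Z with finitely many values; X carries no
   topology, so this is a finite sum over the values of Z. *)
Definition simple_integral d (Omega : measurableType d)
    (P : probability Omega R) (A : set Omega) (Z : Omega -> X) : X :=
  \sum_(x \in range Z) fine (P (A `&` Z @^-1` [set x])) *: x.

Definition filtration d (Omega : measurableType d) (T : nat)
    (F : 'I_T.+1 -> set (set Omega)) : Prop :=
  [/\ forall t, sigma_algebra setT (F t),
      forall t, F t `<=` measurable &
      forall s t : 'I_T.+1, (s <= t)%N -> F s `<=` F t].

(* For finitely valued processes, adaptedness is tested on single values, and
   the last clause is E[M_t | F_s] = M_s. *)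
Definition simple_martingale d (Omega : measurableType d)
    (P : probability Omega R) (T : nat) (F : 'I_T.+1 -> set (set Omega))
    (M : 'I_T.+1 -> Omega -> X) : Prop :=
  [/\ filtration F,
      forall t, finite_set (range (M t)),
      forall t x, F t (M t @^-1` [set x]) &
      forall (s t : 'I_T.+1) (A : set Omega), (s <= t)%N -> F s A ->
        simple_integral P A (M t) = simple_integral P A (M s)].

(* The law of (M_0, ..., M_T), as a set function on all subsets of X^(T+1): for
   finitely valued M_t whose level sets are measurable, every preimage below is
   measurable. *)
Definition law d (Omega : measurableType d) (P : probability Omega R)
    (T : nat) (M : 'I_T.+1 -> Omega -> X) : set (T.+1.-tuple X) -> \bar R :=
  fun B => P ((fun w => [tuple M t w | t < T.+1]) @^-1` B).

Definition martingale_laws (T : nat) (x0 : X) :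
    set (set (T.+1.-tuple X) -> \bar R) :=
  [set mu | exists (d : measure_display) (Omega : measurableType d)
      (P : probability Omega R) (F : 'I_T.+1 -> set (set Omega))
      (M : 'I_T.+1 -> Omega -> X),
    [/\ simple_martingale P F M, forall w, M ord0 w = x0 & mu = law P M]].

(* mu[f] for a law mu with finite support. *)
Definition law_integral (T : nat) (mu : set (T.+1.-tuple X) -> \bar R)
    (f : T.+1.-tuple X -> \bar R) : \bar R :=
  (\sum_(z \in [set z | mu [set z] != 0]) mu [set z] * f z)%E.

End SimpleMartingale.
Arguments martingale_laws {R X} T x0.

(* Main.v *)
(* The envelope g^sharp(x) is the supremum of sum_i l_i g(y_i) over the finitely
   supported probability weights (l_i, y_i) with barycenter x: this supremum is
   concave in x and dominates g, and Jensen's inequality makes it minimal.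
   Hence f^{sharp_(T-1)} optimizes the conditional law of the last step.
   Conditioning a martingale on its path up to T - 1 gives
   mu[f] <= mu'[f^{sharp_(T-1)}] for the law mu' of the shortened martingale.
   Conversely, attaching near-optimal weights to every path of length T lets one
   build, step by step, a finitely supported martingale whose mu[f] exceeds any
   real number below f^{sharp(T)}(x_0). *)

Require Import Defs.
From mathcomp Require Import all_boot all_order all_algebra.
From mathcomp Require Import all_classical all_reals all_analysis.
From mathcomp Require Import lra ring.

Set Implicit Arguments.
Unset Strict Implicit.
Unset Printing Implicit Defensive.
Import Order.TTheory GRing.Theory Num.Theory.
Local Open Scope classical_set_scope.
Local Open Scope ring_scope.

(** * Extended-real arithmetic and weighted means *)

Section WeightedMean.
Context {R : realType}.

(** If the sum is undefined, both sides are [-oo], because a positive factor keeps each infinity. *)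
Lemma pmuleDr (r : R) (x y : \bar R) :
  0 < r -> (r%:E * (x + y) = r%:E * x + r%:E * y)%E.
Proof.
move=> r0; have [xy|] := boolP (x +? y)%E; first exact: muleDr.
have r0' : (0%E < r%:E)%E by rewrite lte_fin.
by case: x y => [x||] [y||]//= _; rewrite ?(gt0_muley r0') ?(gt0_muleNy r0').
Qed.

(** Reduces comparisons to real thresholds, which can be split and rescaled without meeting
    infinities. *)
Lemma lee_fin_below (x y : \bar R) :
  (forall c : R, c%:E < x -> c%:E <= y)%E -> (x <= y)%E.
Proof.
case: x y => [x||] [y||] //= xy; rewrite ?leNye ?leey //.
- rewrite lee_fin; apply/ler_addgt0Pr => e e0; rewrite -lerBlDr -lee_fin.
  by apply: xy; rewrite lte_fin ltrBlDr ltrDl.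
- by have := xy (x - 1); rewrite lte_fin ltrBlDr ltrDl ltr01 => /(_ isT).
- by have := xy (y + 1); rewrite ltry lee_fin gerDl ler10 => /(_ isT).
- by have := xy 0; rewrite ltry => /(_ isT).
Qed.

Lemma lt_adde_split (c : R) (x y : \bar R) :
  (c%:E < x + y)%E -> exists2 a : R, (a%:E < x)%E & ((c - a)%:E < y)%E.
Proof.
case: x y => [x||] [y||] //= cxy.
(* Each summand gives up half of the slack [x + y - c]. *)
- rewrite lte_fin in cxy; exists (x - (x + y - c) / 2); rewrite lte_fin; lra.
- by exists (x - 1); rewrite ?ltry// lte_fin; lra.
- by exists (c - y + 1); rewrite ?ltry// lte_fin; lra.
- by exists 0; rewrite ?ltry.
Qed.

Section Points.
Context {T : Type}.
Implicit Types (k : seq (R * T)) (g : T -> \bar R).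

Definition mean k g : \bar R := (\sum_(p <- k) p.1%:E * g p.2)%E.

Definition positive_weights k := all (fun p => 0 < p.1) k.

Definition scale (c : R) k := [seq (c * p.1, p.2) | p <- k].

Lemma positive_weights_scale c k :
  0 < c -> positive_weights k -> positive_weights (scale c k).
Proof.
move=> c0; rewrite /positive_weights all_map; apply: sub_all => p /= p0.
exact: mulr_gt0.
Qed.

Lemma pmule_sumr (c : R) I (r : seq I) (F : I -> \bar R) : 0 < c ->
  (c%:E * \sum_(i <- r) F i = \sum_(i <- r) c%:E * F i)%E.
Proof.
move=> c0; elim: r => [|i r IH]; first by rewrite !big_nil mule0.
by rewrite !big_cons pmuleDr// IH.
Qed.

Lemma mean_scale c k g : 0 < c -> mean (scale c k) g = (c%:E * mean k g)%E.
Proof.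
move=> c0; rewrite /mean big_map pmule_sumr//; apply: eq_bigr => p _ /=.
by rewrite EFinM muleA.
Qed.

Lemma mean_cat k1 k2 g : mean (k1 ++ k2) g = (mean k1 g + mean k2 g)%E.
Proof. exact: big_cat. Qed.

End Points.

Lemma le_mean (T : eqType) (k : seq (R * T)) (g h : T -> \bar R) :
  positive_weights k -> (forall p, p \in k -> (g p.2 <= h p.2)%E) ->
  (mean k g <= mean k h)%E.
Proof.
move=> /allP k0 gh; rewrite /mean big_seq [leRHS]big_seq.
apply: lee_sum => p pk; apply: lee_wpmul2l; last exact: gh.
by rewrite lee_fin ltW// k0.
Qed.

(** A positively weighted mean above a real has no [-oo] term, and its other terms can be lowered to
    reals. The reals [b] depend on the point, not on the list entry, so that they can serve as
    targets path by path. *)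
Lemma mean_approx (T : eqType) (s : seq (R * T)) (v : T -> \bar R) (c : R) :
  positive_weights s -> (c%:E < mean s v)%E ->
  exists b : T -> R, [/\ forall p, p \in s -> (-oo < v p.2)%E,
    forall z, (-oo < v z)%E -> ((b z)%:E < v z)%E &
    (c%:E < mean s (EFin \o b))%E].
Proof.
elim: s c => [|[w z0] s IH] c.
  move=> _; rewrite /mean !big_nil => c0.
  exists (fun z => if v z is r%:E then r - 1 else 0).
  split=> [//|z|]; last by rewrite big_nil.
  by case: (v z) => [r||]//= _; rewrite ?ltry// lte_fin ltrBlDr ltrDl.
move=> /= /andP[w0 s0]; rewrite {1}/mean big_cons => /lt_adde_split[a] /=.
rewrite -lte_pdivrMl// => az0 /(IH _ s0)[b [bs bv cb]].
have vz0 : (-oo < v z0)%E by apply: lt_trans az0; rewrite ltNyr.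
(* [z0] may recur in the tail: the maximum stays below [v z0] and does not lower the mean of the
   tail. *)
pose b' z := if z == z0 then Num.max (w^-1 * a) (b z0) else b z.
exists b'; split.
- by move=> p; rewrite inE => /predU1P[->//|/bs].
- move=> z vz; rewrite /b'; case: eqP => [->|_]; last exact: bv.
  by rewrite EFin_max gt_max az0 bv.
- rewrite /mean big_cons/= -[c](subrKC a) EFinD; apply: lee_ltD => //.
    by rewrite -lee_pdivrMl// /b' eqxx lee_fin le_max lexx.
  apply: lt_le_trans cb _.
  apply: (@le_mean _ s (EFin \o b) (EFin \o b')) => // p _ /=.
  by rewrite /b' lee_fin; case: eqP => [->|//]; rewrite le_max lexx orbT.
Qed.
End WeightedMean.

(** * Jensen's inequality and the envelope as a supremum of means *)

Section ConcaveEnvelope.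
Context {R : realType} {X : lmodType R}.
Implicit Types (k : seq (R * X)) (x : X) (g psi : X -> \bar R).

Definition barycentric k x :=
  [/\ positive_weights k, \sum_(p <- k) p.1 = 1 & \sum_(p <- k) p.1 *: p.2 = x].

Lemma barycentric1 x : barycentric [:: (1, x)] x.
Proof. by split; rewrite /= ?ltr01 ?big_seq1 ?scale1r. Qed.

Lemma sum_weight_gt0 T (p : R * T) (k : seq (R * T)) :
  positive_weights (p :: k) -> 0 < \sum_(q <- p :: k) q.1.
Proof.
elim: k p => [|q k IH] p /andP[p0 k0]; first by rewrite big_seq1.
by rewrite big_cons addr_gt0// IH.
Qed.

(** The total weight [w] is arbitrary, so the induction applies to the tail without renormalizing
    it. *)
Lemma jensen_weighted psi p k w :
  concave psi -> positive_weights (p :: k) -> w = \sum_(q <- p :: k) q.1 ->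
  (mean (p :: k) psi <=
   w%:E * psi (w^-1 *: \sum_(q <- p :: k) q.1 *: q.2))%E.
Proof.
move=> cpsi; elim: k p w => [|q k IH] p w /andP[p0 k0].
  move=> ->; rewrite /mean !big_seq1 scalerA mulVf ?scale1r//; exact: lt0r_neq0.
have := IH _ _ k0 erefl; set v := \sum_(_ <- _) _ => IHk.
have v0 : 0 < v by exact: sum_weight_gt0.
rewrite big_cons -/v => wE.
have w0 : 0 < w by rewrite wE addr_gt0.
rewrite /mean big_cons; apply: le_trans (leeD (le_refl _) IHk) _.
rewrite [\sum_(_ <- [:: p, q & k]) _]big_cons scalerDr.
set y := \sum_(_ <- _) _.
(* The head has share [p.1 / w] of the total weight; the barycenter of the tail has share
   [v / w]. *)
have l01 : 0 < p.1 / w < 1.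
  by rewrite divr_gt0//= ltr_pdivrMr// mul1r wE ltrDl.
have lE : 1 - p.1 / w = v / w.
  by rewrite wE; field; rewrite -wE; exact: lt0r_neq0.
have := cpsi p.2 (v^-1 *: y) _ l01; rewrite lE scalerA.
rewrite (_ : v / w / v = w^-1); last by field; rewrite !lt0r_neq0.
move=> /(lee_wpmul2l (ltW w0 : (0%:E <= w%:E)%E)) /=.
rewrite pmuleDr// !muleA -!EFinM ![w * _]mulrC !divfK ?lt0r_neq0//.
by rewrite scalerA [w^-1 * _]mulrC.
Qed.

Lemma jensen psi k x :
  concave psi -> barycentric k x -> (mean k psi <= psi x)%E.
Proof.
move=> cpsi [k0 k1 <-]; case: k k0 k1 => [_|p k k0 k1].
  by rewrite big_nil => /eqP; rewrite eq_sym oner_eq0.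
have := jensen_weighted cpsi k0 (esym k1).
by rewrite mul1e invr1 scale1r.
Qed.

Lemma mean_le_envelope g k x :
  barycentric k x -> (mean k g <= concave_envelope g x)%E.
Proof.
move=> kx; apply/ereal_infP => _ [psi [cpsi gpsi] <-].
by apply: le_trans (jensen cpsi kx); case: kx => k0 _ _; apply: le_mean.
Qed.

Definition mean_hull g x : \bar R :=
  ereal_sup [set mean k g | k in barycentric^~ x].

Lemma barycentric_mix k1 k2 x y (l : R) : 0 < l < 1 ->
  barycentric k1 x -> barycentric k2 y ->
  barycentric (scale l k1 ++ scale (1 - l) k2) (l *: x + (1 - l) *: y).
Proof.
move=> /andP[l0]; rewrite -subr_gt0 => l1 [k0 k1E <-] [k0' k1E' <-]; split.
- rewrite /positive_weights all_cat -!/(positive_weights _).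
  by rewrite !positive_weights_scale.
- rewrite big_cat !big_map -!mulr_sumr k1E k1E' !mulr1 /=.
  exact: subrKC.
- rewrite big_cat !big_map !scaler_sumr.
  by congr (_ + _); apply: eq_bigr => p _; rewrite scalerA.
Qed.

(** Lists for [x] and [y] mix, after scaling, into a list for the combined point. Splitting a real
    below the left side tells how near to optimal each must be. *)
Lemma mean_hull_concave g : concave (mean_hull g).
Proof.
move=> x y l l01; have /andP[l0] := l01; rewrite -subr_gt0 => l1.
apply: lee_fin_below => c /lt_adde_split[a].
rewrite -lte_pdivrMl// => /ereal_sup_gt[_ [k1 k1x <-] ak].
rewrite -lte_pdivrMl// => /ereal_sup_gt[_ [k2 k2y <-] bk].
apply: (@le_trans _ _ (mean (scale l k1 ++ scale (1 - l) k2) g)).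
  rewrite mean_cat !mean_scale// -[c](subrKC a) EFinD.
  by apply: leeD; rewrite -lee_pdivrMl// ltW.
apply: ereal_sup_ubound; exists (scale l k1 ++ scale (1 - l) k2) => //.
exact: barycentric_mix.
Qed.

Lemma le_mean_hull g x : (g x <= mean_hull g x)%E.
Proof.
apply: ereal_sup_ubound; exists [:: (1, x)]; first exact: barycentric1.
by rewrite /mean big_seq1 mul1e.
Qed.

(** [mean_hull g] is itself a concave majorant of [g], hence bounds the envelope from above. *)
Lemma lt_envelope_mean g x (c : \bar R) : (c < concave_envelope g x)%E ->
  exists2 k, barycentric k x & (c < mean k g)%E.
Proof.
move=> cg; suff /ereal_sup_gt[_ [k kx <-] ck] : (c < mean_hull g x)%E.
  by exists k.
apply: lt_le_trans cg _; apply: ereal_inf_lbound; exists (mean_hull g) => //.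
by split; [exact: mean_hull_concave|exact: le_mean_hull].
Qed.

End ConcaveEnvelope.

(** The list may exceed the support: extra terms vanish, since zero times an infinite [f z] is
    zero. *)
Lemma law_integral_seq (R : realType) (X : lmodType R) T
    (mu : set (T.+1.-tuple X) -> \bar R) (f : T.+1.-tuple X -> \bar R)
    (r : seq (T.+1.-tuple X)) :
  uniq r -> (forall z, z \notin r -> mu [set z] = 0%E) ->
  law_integral mu f = (\sum_(z <- r) mu [set z] * f z)%E.
Proof.
move=> ur mu0; apply: fsbig_fwiden => // z /=.
- by apply: contraR => /mu0 ->.
- move=> [_] /negP; rewrite negbK => /eqP; rewrite /preimage/= => ->.
  by rewrite mul0e.
Qed.

(** * Paths of finitely valued processes *)

Section Path.
Context {Omega X : Type}.

Definition trajectory n (M : 'I_n -> Omega -> X) (w : Omega) : n.-tuple X :=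
  [tuple M t w | t < n].

Lemma trajectory_rcons n (M : 'I_n.+1 -> Omega -> X) w :
  trajectory M w =
  [tuple of rcons (trajectory (fun t => M (widen_ord (leqnSn n) t)) w)
                  (M ord_max w)].
Proof.
apply: eq_from_tnth => t; rewrite tnth_mktuple (tnth_nth (M ord_max w)) /=.
rewrite nth_rcons size_map size_enum_ord; case: ltnP => tn.
  rewrite (nth_map (Ordinal tn)) ?size_enum_ord//.
  by congr (M _ w); apply: val_inj; rewrite /= nth_enum_ord.
have -> : t = ord_max by apply/val_inj/eqP; rewrite eqn_leq -ltnS ltn_ord.
by rewrite eqxx.
Qed.

End Path.

Lemma rcons_tuple_inj (T : Type) n (z z' : n.-tuple T) (y y' : T) :
  [tuple of rcons z y] = [tuple of rcons z' y'] -> z = z' /\ y = y'.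
Proof.
by move=> /(congr1 val) /rcons_inj [zz' ->]; split=> //; exact: val_inj.
Qed.

Lemma trajectory_in_seq (Omega : Type) (X : eqType) n (M : 'I_n -> Omega -> X) :
  (forall t, finite_set (range (M t))) ->
  exists2 r : seq (n.-tuple X), uniq r & forall w, trajectory M w \in r.
Proof.
elim: n M => [|n IH] M Mfin.
  by exists [:: [tuple]] => // w; rewrite tuple0 inE.
have [r _ rN] := IH (fun t => M (widen_ord (leqnSn n) t)) (fun=> Mfin _).
have /finite_seqP[E ME] := Mfin ord_max.
exists (undup [seq [tuple of rcons (z : n.-tuple X) y] | z <- r, y <- E]).
  exact: undup_uniq.
move=> w; rewrite mem_undup trajectory_rcons; apply: allpairs_f => //.
have : range (M ord_max) (M ord_max w) by exists w.
by rewrite ME.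
Qed.

(** * Finite integrals, restriction to fewer times, and path events *)

Section Restriction.
Context {R : realType} {X : lmodType R} {d : measure_display}.
Context {Omega : measurableType d} (P : probability Omega R).

Lemma probability_fineK A : measurable A -> (fine (P A))%:E = P A.
Proof. by move=> mA; rewrite fineK// fin_num_measure. Qed.

Lemma sum_probability_fibers (Z : Omega -> X) (E : seq X) A :
  uniq E -> range Z = [set` E] -> measurable A ->
  (forall x, measurable (Z @^-1` [set x])) ->
  \sum_(y <- E) fine (P (A `&` Z @^-1` [set y])) = fine (P A).
Proof.
move=> uE ZE mA mZ.
have -> : P A = P (\bigcup_(y in [set` E]) (A `&` Z @^-1` [set y])).
  congr (P _); apply/seteqP; split=> w /=; last by case=> y _ [].
  move=> Aw; exists (Z w) => //.
  by have : range Z (Z w) by [exists w]; rewrite ZE.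
rewrite measure_fin_bigcup//; first last.
- by move=> y _; exact: measurableI.
- by move=> x y _ _ [w [[_ <-] [_ <-]]].
- by rewrite -ZE; apply/finite_seqP; exists E.
- rewrite -fsbig_seq//.
  rewrite -[LHS]/(fine (_%:E)) -sumEFin; congr fine; apply: eq_bigr => y _.
  exact/probability_fineK/measurableI.
Qed.

Lemma simple_integral_seq (Z : Omega -> X) (E : seq X) A :
  uniq E -> range Z = [set` E] ->
  simple_integral P A Z =
  \sum_(y <- E) fine (P (A `&` Z @^-1` [set y])) *: y.
Proof. by move=> uE ZE; rewrite /simple_integral ZE -fsbig_seq. Qed.

Lemma simple_integral_cst (Z : Omega -> X) A x :
  (forall w, A w -> Z w = x) -> simple_integral P A Z = fine (P A) *: x.
Proof.
move=> ZA; have [[w Aw]|A0] := pselect (A !=set0); last first.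
  have -> : A = set0.
    by apply/seteqP; split=> // w Aw; case: A0; exists w.
  rewrite measure0 scale0r /simple_integral fsbig1// => y _.
  by rewrite set0I measure0 scale0r.
have rx : range Z x by exists w; rewrite ?ZA.
rewrite /simple_integral (fsbigE [:: x])//.
- rewrite big_cons big_nil mem_set//= addr0// (_ : A `&` _ = A)//.
  by apply/seteqP; split=> v /=; [case|split=> //; exact: ZA].
- by move=> y /=; rewrite inE => /eqP ->.
- move=> y _; rewrite inE => /eqP yx.
  rewrite (_ : A `&` _ = set0) ?measure0 ?scale0r//.
  by apply/seteqP; split=> // v [/ZA Zx /= Zy]; case: yx; rewrite -Zx -Zy.
Qed.

Context {T : nat} (F : 'I_T.+2 -> set (set Omega)) (M : 'I_T.+2 -> Omega -> X).
Let F' t := F (widen_ord (leqnSn T.+1) t).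
Let M' t := M (widen_ord (leqnSn T.+1) t).

Lemma simple_martingale_restrict :
  simple_martingale P F M -> simple_martingale P F' M'.
Proof.
case=> -[Fs Fm Fle] Mfin MF ME; split=> //.
- by split=> [t|t|s t st]; [exact: Fs|exact: Fm|exact: Fle].
- by move=> t; exact: Mfin.
- by move=> t x; exact: MF.
- by move=> s t A st; exact: ME.
Qed.

End Restriction.

Lemma trajectory_fiber_mem (Omega : Type) X T
    (F : 'I_T.+1 -> set (set Omega)) (M : 'I_T.+1 -> Omega -> X) t z :
  sigma_algebra setT (F t) ->
  (forall s, F s `<=` F t) -> (forall s x, F s (M s @^-1` [set x])) ->
  F t (trajectory M @^-1` [set z]).
Proof.
move=> [F0 FC FU] Fle MF.
(* A finite intersection written with complements and a countable union; [inord] sends the indices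
   beyond [T] back to 0, which only repeats a level set. *)
have -> : trajectory M @^-1` [set z] =
  setT `\` \bigcup_k (setT `\` M (inord k) @^-1` [set tnth z (inord k)]).
  apply/seteqP; split=> w /=.
    by move=> <-; split=> // -[k _ [_]]; rewrite /= tnth_mktuple.
  move=> [_ nw]; apply: eq_from_tnth => s; rewrite tnth_mktuple.
  by apply: contrapT => sw; apply: nw; exists s => //; rewrite inord_val.
by apply/FC/FU => k; apply/FC/(Fle _ _ (MF _ _)).
Qed.

(** * Upper bound: conditioning on the path before the last step *)

Section Step.
Context {R : realType} {X : lmodType R} {d : measure_display}.
Context {Omega : measurableType d} (P : probability Omega R).
Context {T : nat} (F : 'I_T.+2 -> set (set Omega)) (M : 'I_T.+2 -> Omega -> X).
Let F' t := F (widen_ord (leqnSn T.+1) t).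
Let M' t := M (widen_ord (leqnSn T.+1) t).
Hypothesis mM : simple_martingale P F M.

(** On the event that the path so far is [z], the martingale identity puts the barycenter of the
    conditional law of the last step at the endpoint of [z], so [mean_le_envelope] applies. *)
Lemma conditional_sum_le (f : T.+2.-tuple X -> \bar R) (E : seq X)
    (z : T.+1.-tuple X) :
  uniq E -> range (M ord_max) = [set` E] ->
  (\sum_(y <- E) law P M [set [tuple of rcons z y]] * f [tuple of rcons z y]
   <= law P M' [set z] * sharp_at f z)%E.
Proof.
move=> uE ME; have [[Fs Fm Fle] Mfin MF MM] := mM.
pose A := trajectory M' @^-1` [set z].
have FA : F (widen_ord (leqnSn T.+1) ord_max) A.
  apply: (@trajectory_fiber_mem _ _ _ F' M' ord_max) => //.
  - exact: Fs.
  - by move=> s; apply: Fle; rewrite /= -ltnS.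
  - by move=> s x; exact: MF.
have mA : measurable A by exact: Fm FA.
have mMx x : measurable (M ord_max @^-1` [set x]) by exact: Fm (MF _ _).
pose q y := fine (P (A `&` M ord_max @^-1` [set y])).
have q0 y : 0 <= q y by exact: fine_ge0.
have lawE y : law P M [set [tuple of rcons z y]] = (q y)%:E.
  rewrite /q probability_fineK; last exact: measurableI.
  congr (P _); apply/seteqP; split=> w /=;
    rewrite -/(trajectory M w) trajectory_rcons.
    by move=> e; have [zw yw] := rcons_tuple_inj e; split.
  by move=> [zw yw]; rewrite -[z]zw -[y]yw.
have qE : \sum_(y <- E) q y = fine (P A) by exact: sum_probability_fibers.
have -> : law P M' [set z] = (fine (P A))%:E by rewrite probability_fineK.
(* Up to normalization, [k] is the law of the last step conditioned on [A]. *)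
pose k := [seq (q y, y) | y <- E & 0 < q y].
have k0 : positive_weights k.
  rewrite /positive_weights all_map; apply/allP => y.
  by rewrite mem_filter => /andP[].
(* Dropping null weights keeps every sum whose terms vanish at weight 0; this serves for sums in
   [\bar R], [R] and [X]. *)
have kE (I : Type) (idx : I) (op : Monoid.com_law idx) (h : R * X -> I) :
    (forall y, h (0, y) = idx) ->
    \big[op/idx]_(p <- k) h p = \big[op/idx]_(y <- E) h (q y, y).
  move=> h0; rewrite big_map big_filter [RHS](bigID (fun y => 0 < q y))/=.
  rewrite [X in _ = op _ X]big1 ?Monoid.mulm1// => y.
  by rewrite lt0r q0 andbT negbK => /eqP ->.
under eq_bigr do rewrite lawE.
pose g y := f [tuple of rcons z y].
have <- : mean k g = (\sum_(y <- E) (q y)%:E * g y)%E.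
  by apply: (kE _ _ _ (fun p => p.1%:E * g p.2)%E) => y; rewrite mul0e.
(* On a null event no conditional law exists, but both sides are 0, even if the envelope is
   infinite. *)
have [p0|] := eqVneq (fine (P A)) 0.
  have -> : k = [::]; last by rewrite p0 mul0e /mean big_nil.
  rewrite /k (@eq_filter _ _ pred0) ?filter_pred0// => y.
  apply/negbTE; rewrite -leNgt -p0.
  apply: fine_le; rewrite ?fin_num_measure//; first exact: measurableI.
  by apply: le_measure; rewrite ?inE//; exact: measurableI.
set p := fine (P A); move=> p_neq0.
have p0 : 0 < p by rewrite lt0r p_neq0 fine_ge0.
have kz : barycentric (scale p^-1 k) (tnth z ord_max).
  split; first by apply: positive_weights_scale; rewrite ?invr_gt0.
  - by rewrite big_map -mulr_sumr (kE _ _ _ (fun p => p.1))//= qE mulVf.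
  - rewrite big_map; under eq_bigr do rewrite -scalerA.
    rewrite -scaler_sumr (kE _ _ _ (fun p => p.1 *: p.2)) => [/=|y];
      last exact: scale0r.
    (* The integral over [A] moves back one time, where the process is constant on [A]. *)
    rewrite -(simple_integral_seq P A uE ME) (MM _ _ _ _ FA) ?leqnSn//.
    rewrite (@simple_integral_cst _ _ _ _ _ _ _ (tnth z ord_max)).
      by rewrite scalerA mulVf// scale1r.
    by move=> w <-; rewrite tnth_mktuple.
rewrite -[leLHS]mul1e -(divff p_neq0) EFinM -muleA -mean_scale ?invr_gt0//.
by apply: lee_wpmul2l; [rewrite lee_fin ltW|exact: mean_le_envelope].
Qed.

(** Listing the long paths as one-point extensions of the short ones groups the integral by
    prefix. *)
Lemma law_integral_le_sharp (f : T.+2.-tuple X -> \bar R) :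
  (law_integral (law P M) f <= law_integral (law P M') (sharp_at f))%E.
Proof.
have [[Fs Fm Fle] Mfin MF MM] := mM.
have [r ur rM] := trajectory_in_seq (fun t => Mfin (widen_ord (leqnSn T.+1) t)).
have /finite_seqP[E0 ME0] := Mfin ord_max.
have uE := undup_uniq E0; set E := undup E0 in uE.
have ME : range (M ord_max) = [set` E].
  by rewrite ME0; apply/seteqP; split=> y /=; rewrite mem_undup.
rewrite (@law_integral_seq _ _ _ (law P M') _ r)//; last first.
  move=> z /negP zr; rewrite /law (_ : _ @^-1` _ = set0) ?measure0//.
  by apply/seteqP; split=> // w /= wz; apply: zr; rewrite -wz; exact: rM.
pose ext (z : T.+1.-tuple X) y := [tuple of rcons z y].
rewrite (@law_integral_seq _ _ _ _ _ [seq ext z y | z <- r, y <- E]);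
  last first.
- move=> z /negP zr; rewrite /law (_ : _ @^-1` _ = set0) ?measure0//.
  apply/seteqP; split=> // w /= wz; apply: zr.
  rewrite -wz -/(trajectory M w) trajectory_rcons.
  apply: allpairs_f; first exact: rM.
  by have : range (M ord_max) (M ord_max w) by [exists w]; rewrite ME.
- apply: allpairs_uniq => // -[z y] [z' y'] _ _ e.
  by have [-> ->] := rcons_tuple_inj e.
rewrite big_allpairs_dep; apply: lee_sum => z _.
exact: conditional_sum_le.
Qed.
End Step.

Lemma martingale_le_sharp (R : realType) (X : lmodType R) d
    (Omega : measurableType d) (P : probability Omega R) T F
    (M : 'I_T.+1 -> Omega -> X) (f : T.+1.-tuple X -> \bar R) x0 :
  simple_martingale P F M -> (forall w, M ord0 w = x0) ->
  (law_integral (law P M) f <= sharp T f [tuple x0])%E.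
Proof.
elim: T => [|T IH] in F M f *; move=> mM M0 /=.
  have path0 w : [tuple M t w | t < 1] = [tuple x0].
    by apply: eq_from_tnth => t; rewrite tnth_mktuple ord1 M0 tnth0.
  rewrite (@law_integral_seq _ _ _ _ _ [:: [tuple x0]])//.
    rewrite big_seq1 /law (_ : _ @^-1` _ = setT) ?probability_setT ?mul1e//.
    by apply/seteqP; split=> // w _ /=.
  move=> z; rewrite inE => /eqP zx.
  rewrite /law (_ : _ @^-1` _ = set0) ?measure0//.
  by apply/seteqP; split=> // w /=; rewrite path0 => /esym.
apply: le_trans (law_integral_le_sharp mM f) _.
apply: IH (simple_martingale_restrict mM) _ => w.
by rewrite -(M0 w); congr (M _ w); exact: val_inj.
Qed.

(** * Lower bound: weighted path lists grown step by step *)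

Section MartingaleTree.
Context {R : realType} {X : lmodType R} (x0 : X).

(** Natural indices through [nth] avoid ordinal casts when paths are lengthened. *)
Definition depends_up_to T i (phi : T.-tuple X -> R) :=
  forall z z' : T.-tuple X,
    (forall k, (k <= i)%N -> nth x0 z k = nth x0 z' k) -> phi z = phi z'.

(* A weighted list of paths; the last clause is E[phi(M) (M_j - M_i)] = 0 for
   every phi depending only on M_0, ..., M_i. *)
Definition martingale_weights T (s : seq (R * T.+1.-tuple X)) :=
  [/\ positive_weights s, \sum_(p <- s) p.1 = 1,
      forall p, p \in s -> nth x0 p.2 0 = x0 &
      forall i j (phi : T.+1.-tuple X -> R), (i <= j <= T)%N ->
        depends_up_to i phi ->
        \sum_(p <- s) (p.1 * phi p.2) *: (nth x0 p.2 j - nth x0 p.2 i) = 0].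

Definition refine T (s : seq (R * T.-tuple X))
    (k : T.-tuple X -> seq (R * X)) : seq (R * T.+1.-tuple X) :=
  [seq (p.1 * q.1, [tuple of rcons (p.2 : T.-tuple X) q.2])
     | p <- s, q <- k p.2].

Lemma martingale_weights1 : @martingale_weights 0 [:: (1, [tuple x0])].
Proof.
split=> [||p|i j phi]; rewrite ?big_seq1 //= ?ltr01//.
  by rewrite inE => /eqP ->.
rewrite leqn0 => /andP[ij /eqP j0]; move: ij.
by rewrite j0 leqn0 => /eqP ->; rewrite subrr scaler0.
Qed.

(** A test function of the past ignores the new coordinate, and averaging that coordinate over [k]
    returns the previous endpoint, so each identity reduces to one for [s]. *)
Lemma martingale_weights_refine T (s : seq (R * T.+1.-tuple X)) k :
  martingale_weights s ->
  (forall z : T.+1.-tuple X, barycentric (k z) (nth x0 z T)) ->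
  martingale_weights (refine s k).
Proof.
move=> [s0 s1 sx0 sM] kz; split.
- apply/allP => _ /allpairsPdep[p [q [ps qk ->]]] /=.
  rewrite mulr_gt0 ?(allP s0)//; have [k0 _ _] := kz p.2; exact: (allP k0).
- rewrite big_allpairs_dep -[RHS]s1; apply: eq_bigr => p _ /=.
  by have [_ k1 _] := kz p.2; rewrite -mulr_sumr k1 mulr1.
- move=> _ /allpairsPdep[p [q [ps qk ->]]] /=.
  by rewrite nth_rcons size_tuple /= sx0.
move=> i j phi /andP[ij jT] dphi.
(* Only for [i < j] is [phi] sure not to see the new coordinate; for [i = j] the increment is
   zero. *)
have [->|i_neq_j] := eqVneq i j.
  by rewrite big1// => p _; rewrite subrr scaler0.
have iT : (i < T.+1)%N by apply: leq_trans jT; rewrite ltn_neqAle i_neq_j.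
pose psi (z : T.+1.-tuple X) := phi [tuple of rcons z x0].
have dpsi : depends_up_to i psi.
  move=> z z' zz'; apply: dphi => l li /=; rewrite !nth_rcons !size_tuple.
  by rewrite (leq_ltn_trans li iT) zz'.
have phiE (z : T.+1.-tuple X) y : phi [tuple of rcons z y] = psi z.
  apply: dphi => l li /=; rewrite !nth_rcons !size_tuple.
  by rewrite (leq_ltn_trans li iT).
(* After averaging, coordinate [T.+1] becomes coordinate [T], and the earlier ones are unchanged. *)
have ijT : (i <= minn j T <= T)%N by rewrite leq_min ij -ltnS iT geq_minr.
rewrite -[RHS](sM i (minn j T) psi)//.
rewrite big_allpairs_dep; apply: eq_bigr => p _ /=.
have [_ k1 kb] := kz p.2.
under eq_bigr do rewrite phiE mulrAC -scalerA.
rewrite -scaler_sumr; congr (_ *: _).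
under eq_bigr do rewrite !nth_rcons !size_tuple iT scalerBr.
rewrite big_split/= sumrN -scaler_suml k1 scale1r; congr (_ - _).
case: ltngtP jT => [jT _|//|-> _].
  by rewrite -scaler_suml k1 scale1r (minn_idPl _).
by rewrite kb (minn_idPr _).
Qed.

(** Induction yields short paths that are good for [sharp_at f]; [mean_approx] sets a real target at
    each, and the envelope supplies a last step beating it. *)
Lemma lt_sharp_mean T (f : T.+1.-tuple X -> \bar R) (c : R) :
  (c%:E < sharp T f [tuple x0])%E ->
  exists2 s, martingale_weights s & (c%:E < mean s f)%E.
Proof.
elim: T f => [|T IH] f /= cf.
  exists [:: (1, [tuple x0])]; first exact: martingale_weights1.
  by rewrite /mean big_seq1 mul1e.
have [s sM /mean_approx[|b [vs bv cb]]] := IH _ cf; first by case: sM.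
have lastE (z : T.+1.-tuple X) : tnth z ord_max = nth x0 z T.
  exact: tnth_nth.
have /choice[k kP] : forall z : T.+1.-tuple X, exists k,
    barycentric k (nth x0 z T) /\ ((-oo < sharp_at f z)%E ->
      ((b z)%:E < mean k (fun y => f [tuple of rcons z y]))%E).
  move=> z; have [vz|] := boolP (-oo < sharp_at f z)%E.
    by have [k kz bk] := lt_envelope_mean (bv z vz); exists k; rewrite -lastE.
  (* Where the envelope is [-oo] there is no target, and the path simply stays put. *)
  by exists [:: (1, nth x0 z T)]; split => //; exact: barycentric1.
have kz (z : T.+1.-tuple X) : barycentric (k z) (nth x0 z T) by case: (kP z).
exists (refine s k); first exact: martingale_weights_refine.
have s0 : positive_weights s by case: sM.
pose g (z : T.+1.-tuple X) := mean (k z) (fun y => f [tuple of rcons z y]).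
have -> : mean (refine s k) f = mean s g.
  rewrite /mean big_allpairs_dep; apply: eq_big_seq => p ps /=.
  rewrite pmule_sumr; last exact: (allP s0).
  by apply: eq_bigr => q _; rewrite EFinM muleA.
apply: lt_le_trans cb _; apply: le_mean => // p ps.
by apply/ltW; apply: (kP p.2).2; exact: vs.
Qed.

End MartingaleTree.

(** * Realizing weighted path lists as laws of martingales *)

Section Realization.
Context {R : realType} {X : lmodType R}.

Lemma finite_probability n (w : nat -> R) :
  (forall i, 0 <= w i) -> \sum_(i < n) w i = 1 ->
  exists P : probability nat R,
    forall A, P A = (\sum_(i < n) w i * (nat_of_ord i \in A)%:R)%:E.
Proof.
move=> w0 w1; pose m i := mscale (NngNum (w0 i)) (\d_i : measure nat R).
pose mu : measure nat R := msum m n.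
have mE A : mu A = (\sum_(i < n) w i * (nat_of_ord i \in A)%:R)%:E.
  rewrite /mu/= /msum -sumEFin; apply: eq_bigr => i _.
  by rewrite /m/= /mscale/= diracE EFinM.
have m1 : mu setT = 1%E.
  by rewrite mE; under eq_bigr do rewrite in_setT mulr1; rewrite w1.
(* The mass is already 1: normalizing only packages [mu] as a probability. *)
exists (mnormalize mu (\d_0%N : probability nat R)) => A.
rewrite -mE -[LHS]/(mnormalize mu \d_0%N A) /mnormalize m1 onee_eq0/=.
by rewrite invr1 mule1.
Qed.

Variables (T : nat) (x0 : X) (s : seq (R * T.+1.-tuple X)).
Hypothesis sM : martingale_weights x0 s.

Let n := size s.
(* The sample space is nat; the points beyond [n] carry weight 0 and the path
   that is constantly [x0]. *)
Let leaf i := nth (0, [tuple of nseq T.+1 x0]) s i.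
Let w i := (leaf i).1.
Let M (t : 'I_T.+1) i := tnth (leaf i).2 t.
(* The natural filtration of [M]: [A] is saturated for agreement up to [t]. *)
Let F (t : 'I_T.+1) : set (set nat) :=
  [set A | forall i j, (forall k : 'I_T.+1, (k <= t)%N -> M k i = M k j) ->
           A i -> A j].

Let s_sum (I : Type) (idx : I) (op : Monoid.law idx) (h : R * _ -> I) :
  \big[op/idx]_(p <- s) h p = \big[op/idx]_(i < n) h (leaf i).
Proof. by rewrite (big_nth (0, [tuple of nseq T.+1 x0])) big_mkord. Qed.

Let w0 i : 0 <= w i.
Proof.
rewrite /w /leaf; have [si|si] := leqP n i; first by rewrite nth_default.
by have [/allP s0 _ _ _] := sM; rewrite ltW// s0 ?mem_nth.
Qed.

Let Mfin t : finite_set (range (M t)).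
Proof.
apply: (@sub_finite_set _ _ [set` x0 :: [seq tnth p.2 t | p <- s]]).
  move=> _ [i _ <-] /=; rewrite /M /leaf inE; have [si|si] := leqP n i.
    by rewrite nth_default//= tnth_nseq eqxx.
  by rewrite (map_f (fun p => tnth p.2 t)) ?orbT// mem_nth.
exact: finite_seq.
Qed.

(** Agreement up to [t] is an equivalence relation, finer for later [t]; its symmetry gives closure
    under complement. *)
Let filtrationF : filtration F.
Proof.
split=> [t|t A _ //|u v uv A FA i j ij].
- split=> [i j _ []|A FA i j ij [_ nAi]|A FA i j ij [k _ Aki]].
  + by split=> // Aj; apply: nAi; apply: FA Aj => k kt; rewrite ij.
  + by exists k => //; exact: FA Aki.
- by apply: FA => k ku; apply: ij; exact: leq_trans ku uv.
Qed.

Variable P : probability nat R.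
Hypothesis PE : forall A, P A = (\sum_(i < n) w i * (nat_of_ord i \in A)%:R)%:E.

Let integralE t A :
  simple_integral P A (M t) =
  \sum_(i < n) (w i * (nat_of_ord i \in A)%:R) *: M t i.
Proof.
have /finite_seqP[E0 ME] := Mfin t.
rewrite (@simple_integral_seq _ _ _ _ _ _ (undup E0)) ?undup_uniq//; last first.
  by rewrite ME; apply/seteqP; split=> y /=; rewrite mem_undup.
under eq_bigr do rewrite PE/= scaler_suml.
rewrite exchange_big; apply: eq_bigr => i _ /=.
rewrite (bigD1_seq (M t i)) ?undup_uniq//=; last first.
  by have : range (M t) (M t i) by [exists i]; rewrite ME mem_undup.
rewrite big1 ?addr0 => [|y yM].
  congr ((_ * _%:R) *: _); congr nat_of_bool.
  by apply/idP/idP; rewrite !inE => // -[].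
rewrite (_ : _ \in _ = false) ?mulr0 ?scale0r//.
by apply/negP; rewrite inE => -[_ /= /esym /eqP]; apply/negP.
Qed.

(** The martingale identity over [A] is the last clause of [martingale_weights], tested on the
    indicator of [A]. *)
Lemma weights_martingale : simple_martingale P F M.
Proof.
split=> [||t x i j ij /= <-|u v A uv FA]; [exact: filtrationF|exact: Mfin| |].
  by rewrite ij.
apply/eqP; rewrite -subr_eq0 !integralE -sumrB; apply/eqP.
(* Since [A] is saturated, [phi (leaf i).2] is the indicator of [i \in A]. *)
pose phi (z : T.+1.-tuple X) : R :=
  (`[< exists2 i, A i &
       forall k : 'I_T.+1, (k <= u)%N -> M k i = tnth z k >])%:R.
have dphi : depends_up_to x0 u phi.
  move=> z z' zz'; congr (_%:R); congr nat_of_bool.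
  by apply/asboolP/asboolP => -[i Ai zi]; exists i => // k ku;
    rewrite zi// !(tnth_nth x0) zz'.
have [_ _ _ /(_ u v phi _ dphi)] := sM.
rewrite uv -ltnS ltn_ord => /(_ isT) s0.
rewrite -[RHS]s0 s_sum /=; apply: eq_bigr => i _.
rewrite -scalerBr /M !(tnth_nth x0); congr ((_ * _%:R) *: _).
congr nat_of_bool; apply/idP/asboolP => [/set_mem Ai|[j Aj ji]].
  by exists (nat_of_ord i).
by apply/mem_set/FA/Aj.
Qed.

(** Several indices may carry the same path, so the mass at a path collects all their weights. *)
Lemma law_integral_weights f : law_integral (law P M) f = mean s f.
Proof.
have trajE i : [tuple M t i | t < T.+1] = (leaf i).2.
  by apply: eq_from_tnth => t; rewrite tnth_mktuple.
have lawE z : law P M [set z] = (\sum_(i < n) w i * ((leaf i).2 == z)%:R)%:E.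
  rewrite /law PE; congr EFin; apply: eq_bigr => i _; congr (_ * _%:R).
  congr nat_of_bool; apply/idP/eqP; rewrite inE /= trajE//.
have leafs i : (i < n)%N -> (leaf i).2 \in undup (map snd s).
  by move=> ni; rewrite mem_undup map_f// mem_nth.
rewrite (@law_integral_seq _ _ _ _ _ (undup (map snd s))) ?undup_uniq//;
  last first.
  move=> z zs; rewrite lawE big1// => i _.
  rewrite (_ : _ == _ = false) ?mulr0//; apply: contraNF zs => /eqP <-.
  exact: leafs.
rewrite /mean s_sum.
under eq_bigr do rewrite lawE -sumEFin.
(* Distributing a possibly infinite [f z] is sound because the weights are nonnegative. *)
under eq_bigr => z _.
  rewrite ge0_sume_distrl; last by move=> i _; rewrite lee_fin mulr_ge0.
  over.
rewrite exchange_big/=; apply: eq_bigr => i _.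
rewrite (bigD1_seq (leaf i).2) ?undup_uniq//=; last exact: leafs.
rewrite eqxx mulr1 big1 ?adde0// => z; rewrite eq_sym => /negbTE ->.
by rewrite mulr0 mul0e.
Qed.

Lemma weights_start i : M ord0 i = x0.
Proof.
rewrite /M /leaf; have [si|si] := leqP n i.
  by rewrite nth_default//= tnth_nseq.
by have [_ _ sx0 _] := sM; rewrite (tnth_nth x0) sx0 ?mem_nth.
Qed.

Lemma weights_law :
  exists2 mu, martingale_laws T x0 mu & forall f, law_integral mu f = mean s f.
Proof.
exists (law P M); last exact: law_integral_weights.
by do 5 eexists; split; [exact: weights_martingale|exact: weights_start|].
Qed.

End Realization.

Lemma martingale_weights_law (R : realType) (X : lmodType R) T (x0 : X)
    (s : seq (R * T.+1.-tuple X)) : martingale_weights x0 s ->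
  exists2 mu, martingale_laws T x0 mu & forall f, law_integral mu f = mean s f.
Proof.
move=> sM; have [/allP s0 s1 _ _] := sM.
pose e := (0 : R, [tuple of nseq T.+1 x0]).
have [i||P PE] := @finite_probability R (size s) (fun i => (nth e s i).1).
- have [si|si] := leqP (size s) i; first by rewrite nth_default.
  by rewrite ltW// s0 ?mem_nth.
- by rewrite -s1 (big_nth e) big_mkord.
  exact: (@weights_law _ _ _ _ _ sM P PE).
Qed.

Theorem proposition2p1 (R : realType) (X : lmodType R) (T : nat)
    (f : T.+1.-tuple X -> \bar R) (x0 : X) :
  sharp T f [tuple x0] =
  ereal_sup [set law_integral mu f | mu in martingale_laws T x0].
Proof.
apply/eqP; rewrite eq_le; apply/andP; split; last first.
  apply/ereal_supP => _ [_ [d [W [P [F [M [mM M0 ->]]]]]] <-].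
  exact: martingale_le_sharp mM M0.
apply: lee_fin_below => c /lt_sharp_mean[s sM /ltW cs].
have [mu mu_law mu_s] := martingale_weights_law sM.
by apply: le_trans cs _; rewrite -mu_s; apply: ereal_sup_ubound; exists mu.
Qed.
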